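(* There is no integer $k_0$ such that every finite convex geometry is isomorphic to $(\mathscr K,\operatorname{conv}_{\mathscr K})$ for some finite family $\mathscr K$ of compact convex sets in the plane $\mathbb R^2$ such that any two distinct members of $\mathscr K$ have at most $k_0$ common supporting lines.
   Context: A (finite) convex geometry is a pair $(E,\Phi)$ where $E$ is a finite set and $\Phi:2^E\to 2^E$ is a closure operator with $\Phi(\emptyset)=\emptyset$ satisfying the anti-exchange property: if $A\subseteq E$, $x,y\in E\setminus\Phi(A)$ and $\Phi(A\cup\{x\})=\Phi(A\cup\{y\})$, then $x=y$. The convex sets of the geometry are the sets $X\subseteq E$ with $\Phi(X)=X$. Two convex geometries on $E_1$ and $E_2$ are isomorphic if there is a bijection $\varphi:E_1\to E_2$ such that $X\subseteq E_1$ is convex iff $\varphi(X)$ is convex. Compact convex sets are understood to be nonempty. For a finite family $\mathscr K$ of compact convex sets in $\mathbb R^2$ and $\mathscr S\subseteq\mathscr K$, $$\operatorname{conv}_{\mathscr K}(\mathscr S)=\Big\{K\in\mathscr K:\ K\subseteq\operatorname{conv}\Big(\bigcup_{S\in\mathscr S}S\Big)\Big\},$$ where $\operatorname{conv}$ is the usual convex hull in $\mathbb R^2$. A line $l$ is a supporting line of a compact convex set $K\subset\mathbb R^2$ if $K\cap l\neq\emptyset$ and $K$ is contained in one of the two closed halfplanes bounded by $l$. A line $l$ is a common supporting line of $K$ and $L$ if it is a supporting line of both $K$ and $L$ and both sets lie in the same closed halfplane of $l$. *)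

(* Defs.v *)
From HB Require Import structures.
From mathcomp Require Import all_boot all_order all_algebra.
From mathcomp Require Import all_classical all_reals all_analysis.

Set Implicit Arguments.
Unset Strict Implicit.
Unset Printing Implicit Defensive.

Import Order.TTheory GRing.Theory Num.Theory numFieldNormedType.Exports.

Local Open Scope classical_set_scope.
Local Open Scope ring_scope.

(* The ground set is a set [E] of elements of [T] rather than a type, so that
   families of planar sets can be ground sets too. Only the values of [Phi] on
   subsets of [E] are constrained. *)
Record convex_geometry (T : Type) (E : set T) (Phi : set T -> set T) : Prop :=
  ConvexGeometry {
    cg_finite : finite_set E;
    cg_stable : forall A, A `<=` E -> Phi A `<=` E;
    cg_extensive : forall A, A `<=` E -> A `<=` Phi A;
    cg_monotone : forall A B,
      A `<=` B -> B `<=` E -> Phi A `<=` Phi B;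
    cg_idempotent : forall A, A `<=` E -> Phi (Phi A) = Phi A;
    cg_empty : Phi set0 = set0;
    cg_anti_exchange : forall A x y, A `<=` E ->
      (E `\` Phi A) x -> (E `\` Phi A) y ->
      Phi (A `|` [set x]) = Phi (A `|` [set y]) -> x = y
  }.

Definition convex_in (T : Type) (E : set T) (Phi : set T -> set T)
    (X : set T) : Prop :=
  X `<=` E /\ Phi X = X.

Definition geometry_isomorphic (T1 T2 : Type)
    (E1 : set T1) (Phi1 : set T1 -> set T1)
    (E2 : set T2) (Phi2 : set T2 -> set T2) : Prop :=
  exists f : T1 -> T2, set_bij E1 E2 f /\
    forall X, X `<=` E1 -> (convex_in E1 Phi1 X <-> convex_in E2 Phi2 (f @` X)).

Notation plane R := ('rV[R]_2).

Section Plane.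
Variable R : realType.
Implicit Types (A K L l H : set (plane R)) (F S : set (set (plane R))).

Definition convex_hull A : set (plane R) :=
  smallest (fun B => @convex_set R (plane R) B) A.

Definition conv_family F S : set (set (plane R)) :=
  [set K | F K /\ K `<=` convex_hull (\bigcup_(L in S) L)].

Definition line (a b c : R) : set (plane R) :=
  [set p | a * p 0 0 + b * p 0 1 = c].

Definition halfplane (a b c : R) : set (plane R) :=
  [set p | a * p 0 0 + b * p 0 1 <= c].

(* Both sides of a line are obtained: negating [a], [b] and [c] keeps the line
   and swaps the halfplanes. In particular, [exists H, bounds l H] says that
   [l] is a line. *)
Definition bounds l H : Prop :=
  exists a b c, [/\ (a, b) != (0, 0), l = line a b c & H = halfplane a b c].

Definition supporting_line K l : Prop :=
  K `&` l !=set0 /\ exists H, bounds l H /\ K `<=` H.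

Definition common_supporting_line K L l : Prop :=
  [/\ supporting_line K l, supporting_line L l
    & exists H, [/\ bounds l H, K `<=` H & L `<=` H]].

Definition compact_convex K : Prop :=
  [/\ K !=set0, compact K & @convex_set R (plane R) K].

End Plane.

(* Main.v *)
(* Adjoin to 2n points, n on the left and n on the right, a point P lying in the
   closure of exactly those sets (not containing it) that are not included in a
   pair {left, right}; this is a convex geometry. In a planar representation,
   each of the n^2 pairs is the set of members whose support function is below
   that of P in a suitable direction. If pairs of members have at most k common
   supporting lines, each of the 2n differences with the support function of P
   has at most k zeros on either half of the circle of directions, so only
   O(k n) sets of members can be below P, which is impossible for large n. *)

Require Import Defs.
From HB Require Import structures.
From mathcomp Require Import all_boot all_order all_algebra.
From mathcomp Require Import all_classical all_reals all_analysis.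
From mathcomp Require Import ring lra zify.

Set Implicit Arguments.
Unset Strict Implicit.
Unset Printing Implicit Defensive.

Import Order.TTheory GRing.Theory Num.Theory numFieldNormedType.Exports.

Local Open Scope classical_set_scope.
Local Open Scope ring_scope.
Local Open Scope card_scope.

(** * Linear forms, convex hulls and strict separation in the plane *)

Definition lin (R : realType) (a b : R) (p : plane R) : R :=
  a * p 0 0 + b * p 0 1.

Section Planar.
Variable R : realType.
Implicit Types (K L A : set (plane R)) (a b c t : R) (p z : plane R).

Lemma lin_continuous a b : continuous (lin a b).
Proof.
move=> p.
exact: (cvgD (cvgM (cvg_cst a) (@coord_continuous R 1 2 0 0 p))
             (cvgM (cvg_cst b) (@coord_continuous R 1 2 0 1 p))).
Qed.

Lemma convex_setE A : @convex_set R (plane R) A <->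
  forall t p q, 0 <= t <= 1 -> A p -> A q -> A (t *: p + (1 - t) *: q).
Proof.
split=> [cA t p q /andP[t0 t1] Ap Aq | cA p q t /set_mem Ap /set_mem Aq].
  by have /set_mem := cA p q (Itv01 t0 t1) (mem_set Ap) (mem_set Aq).
by apply/mem_set/(cA t%:num) => //; rewrite ge0 le1.
Qed.

Lemma convex_hull_convex A : @convex_set R (plane R) (convex_hull A).
Proof.
apply/convex_setE => t p q t01 hp hq B [cB AB].
by move/convex_setE: (cB); apply => //; [apply: hp|apply: hq].
Qed.

Lemma convex_hull_lin_lt a b c A :
  (forall p, A p -> lin a b p < c) ->
  forall p, convex_hull A p -> lin a b p < c.
Proof.
move=> Ac p; apply: (@smallest_sub _ _ A [set q | lin a b q < c]) p => //.
apply/convex_setE => t p q /andP[t0 t1]; rewrite /= /lin !mxE => hp hq.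
have [->|tn0] := eqVneq t 0; first lra.
have {t0}tn0 : 0 < t by rewrite lt_neqAle t0 eq_sym andbT.
nra.
Qed.

(** The combination [(1 - t) (s k + (1 - s) l) + t k'] keeps the weight [(1 - t) (1 - s)] on [l]; by
    convexity, the remaining weight falls on a single point of [K]. *)
Lemma convex_slide K k k' s t : @convex_set R (plane R) K -> K k -> K k' ->
  0 <= s <= 1 -> 0 < t <= 1 ->
  exists2 k'', K k'' & forall j,
    ((1 - t) * s + t) * k'' 0 j = (1 - t) * s * k 0 j + t * k' 0 j.
Proof.
move=> /convex_setE cK Kk Kk' /andP[s0 s1] /andP[t0 t1].
have w0 : 0 < (1 - t) * s + t by nra.
exists ((t / ((1 - t) * s + t)) *: k' + (1 - t / ((1 - t) * s + t)) *: k).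
  apply: cK => //; apply/andP; split; first by apply: divr_ge0; exact: ltW.
  by rewrite ler_pdivrMr//; nra.
by move=> j; rewrite !mxE; field; rewrite gt_eqF.
Qed.

Lemma ge0_of_affine (d q : R) : 0 <= q ->
  (forall t, 0 < t <= 1 -> 0 <= d + t * q) -> 0 <= d.
Proof.
move=> q0 h; rewrite leNgt; apply/negP => d0.
have w0 : 0 < q - d by lra.
(* An explicit [t] replaces the limit at 0: for [d < 0] it lies in the unit interval and makes the
   expression negative. *)
have := h (- d / (q - d)).
have -> : d + - d / (q - d) * q = - d ^+ 2 / (q - d).
  by field; rewrite gt_eqF.
rewrite divr_gt0 ?oppr_gt0//= ler_pdivrMr// mul1r.
have -> : - d <= q - d by lra.
move=> /(_ isT); rewrite ler_pdivlMr// mul0r; nra.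
Qed.

(* Squared distance from [z] to the point [s k + (1 - s) l], where
   [x = (k, (l, s))]. *)
Definition sqdist z (x : plane R * (plane R * R)) : R :=
  (x.2.2 * x.1 0 0 + (1 - x.2.2) * x.2.1 0 0 - z 0 0) ^+ 2 +
  (x.2.2 * x.1 0 1 + (1 - x.2.2) * x.2.1 0 1 - z 0 1) ^+ 2.

Lemma sqdist_continuous z : continuous (sqdist z).
Proof.
have ck j : continuous (fun x : plane R * (plane R * R) => x.1 0 j).
  by move=> x; exact: (continuous_comp cvg_fst (@coord_continuous R 1 2 0 j x.1)).
have c2 : continuous (fun x : plane R * (plane R * R) => x.2).
  by move=> x; exact: cvg_snd.
have c21 : continuous (fun x : plane R * (plane R * R) => x.2.1).
  by move=> x; exact: (continuous_comp (c2 x) cvg_fst).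
have cl j : continuous (fun x : plane R * (plane R * R) => x.2.1 0 j).
  move=> x; exact: (continuous_comp (c21 x) (@coord_continuous R 1 2 0 j x.2.1)).
have cs : continuous (fun x : plane R * (plane R * R) => x.2.2).
  by move=> x; exact: (continuous_comp (c2 x) cvg_snd).
move=> x.
have cc j : {for x, continuous (fun x : plane R * (plane R * R) =>
    x.2.2 * x.1 0 j + (1 - x.2.2) * x.2.1 0 j - z 0 j)}.
  exact: (cvgB (cvgD (cvgM (cs x) (ck j x)) (cvgM
    (cvgB (@cvg_cst R 1 _ _ _) (cs x)) (cl j x))) (@cvg_cst R (z 0 j) _ _ _)).
exact: (cvgD (cvgM (cc 0) (cc 0)) (cvgM (cc 1) (cc 1))).
Qed.

(** The normal is [z - c], where [c] is nearest to [z] among the points of segments joining [K] to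
    [L]. Minimising over triples from [K], [L] and [[0, 1]] makes compactness immediate. *)
Lemma separation K L z : compact_convex K -> compact_convex L ->
  ~ convex_hull (K `|` L) z ->
  exists a b, forall p, (K `|` L) p -> lin a b p < lin a b z.
Proof.
move=> [[k0 Kk0] cptK cK] [[l0 Ll0] cptL cL] nz.
have [||| [k [l s]] /set_mem/= [Kk [Ll]]] :=
    @compact_EVT_min _ R (sqdist z) (K `*` (L `*` `[0, 1])).
- by exists (k0, (l0, 0)); split=> //; split=> //=; rewrite in_itv/= lexx ler01.
- by apply: compact_setX => //; apply: compact_setX => //; exact: segment_compact.
- exact/continuous_subspaceT/sqdist_continuous.
rewrite /= in_itv/= => s01 hmin.
have s01' := s01; move/andP: s01' => [s0 s1].
have {}hmin k' l' s' : K k' -> L l' -> 0 <= s' <= 1 ->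
    sqdist z (k, (l, s)) <= sqdist z (k', (l', s')).
  by move=> Kk' Ll' hs'; apply: hmin; apply/mem_set; split=> //; split=> //=; rewrite in_itv.
pose c := s *: k + (1 - s) *: l.
have hc : convex_hull (K `|` L) c.
  move/convex_setE: (@convex_hull_convex (K `|` L)); apply => //.
    by apply: sub_gen_smallest; left.
  by apply: sub_gen_smallest; right.
have cE j : c 0 j = s * k 0 j + (1 - s) * l 0 j by rewrite !mxE.
have nzc : 0 < (z 0 0 - c 0 0) ^+ 2 + (z 0 1 - c 0 1) ^+ 2.
  rewrite lt_neqAle addr_ge0 ?sqr_ge0// andbT eq_sym paddr_eq0 ?sqr_ge0//.
  rewrite !sqrf_eq0 !subr_eq0; apply/negP => /andP[/eqP e0 /eqP e1].
  apply: nz; suff -> : z = c by [].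
  apply/rowP => -[[|[|//]] i].
    by rewrite (_ : Ordinal i = 0) ?e0//; exact/val_inj.
  by rewrite (_ : Ordinal i = 1) ?e1//; exact/val_inj.
exists (z 0 0 - c 0 0), (z 0 1 - c 0 1) => p KLp.
suff : lin (z 0 0 - c 0 0) (z 0 1 - c 0 1) p <=
       lin (z 0 0 - c 0 0) (z 0 1 - c 0 1) c.
  by move=> /le_lt_trans; apply; rewrite /lin; nra.
(* First-order optimality of [c]: moving by the fraction [t] from [c] towards [p] does not come
   closer to [z], and the change of squared distance divided by [t] is affine in [t]. *)
suff : 0 <= 2 * ((c 0 0 - z 0 0) * (p 0 0 - c 0 0) + (c 0 1 - z 0 1) * (p 0 1 - c 0 1)).
  by rewrite /lin; lra.
apply: (@ge0_of_affine _ ((p 0 0 - c 0 0) ^+ 2 + (p 0 1 - c 0 1) ^+ 2)).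
  by rewrite addr_ge0 ?sqr_ge0.
move=> t t01; have /andP[t0 t1] := t01.
suff : (c 0 0 - z 0 0) ^+ 2 + (c 0 1 - z 0 1) ^+ 2 <=
    ((1 - t) * c 0 0 + t * p 0 0 - z 0 0) ^+ 2 +
    ((1 - t) * c 0 1 + t * p 0 1 - z 0 1) ^+ 2.
  by rewrite -(pmulr_rge0 _ t0) => h; rewrite -subr_ge0 in h; apply: le_trans h _; lra.
case: KLp => [Kp|Lp].
  have [k' Kk' hk'] := convex_slide cK Kk Kp s01 t01.
  have := hmin k' l ((1 - t) * s + t) Kk' Ll.
  have -> : 0 <= (1 - t) * s + t <= 1 by apply/andP; split; nra.
  move=> /(_ isT); rewrite /sqdist /= !hk' !cE.
  by congr (_ ^+ 2 + _ ^+ 2 <= _ ^+ 2 + _ ^+ 2); ring.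
(* For [p] in [L] the roles of [K] and [L] are exchanged, hence the weight [1 - s]. *)
have s01' : 0 <= 1 - s <= 1 by apply/andP; split; lra.
have [l' Ll' hl'] := convex_slide cL Ll Lp s01' t01.
have := hmin k l' (1 - ((1 - t) * (1 - s) + t)) Kk Ll'.
have -> : 0 <= 1 - ((1 - t) * (1 - s) + t) <= 1 by apply/andP; split; nra.
move=> /(_ isT); rewrite /sqdist /= subKr !hl' !cE.
by congr (_ ^+ 2 + _ ^+ 2 <= _ ^+ 2 + _ ^+ 2); ring.
Qed.

(** * Support functions and common supporting lines *)

Definition support a b K := sup (lin a b @` K).

Lemma support_attained a b K : compact_convex K ->
  exists2 p, K p & support a b K = lin a b p.
Proof.
move=> [[k0 Kk0] cptK _].
have [||| p /set_mem Kp hp] := @compact_EVT_max _ R (lin a b) K.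
- by exists k0.
- by [].
- exact/continuous_subspaceT/lin_continuous.
exists p => //; apply/le_anti/andP; split.
  apply: ge_sup; first by exists (lin a b k0), k0.
  by move=> _ [q Kq <-]; apply: hp; exact: mem_set.
apply: ub_le_sup; last by exists p.
by exists (lin a b p) => _ [q Kq <-]; apply: hp; exact: mem_set.
Qed.

Lemma lin_le_support a b K p : compact_convex K -> K p ->
  lin a b p <= support a b K.
Proof.
move=> [[k0 Kk0] cptK _] Kp; apply: ub_le_sup; last by exists p.
have [||| q /set_mem Kq hq] := @compact_EVT_max _ R (lin a b) K.
- by exists k0.
- by [].
- exact/continuous_subspaceT/lin_continuous.
by exists (lin a b q) => _ [q' Kq' <-]; apply: hq; exact: mem_set.
Qed.

Lemma support_lt a b K c : compact_convex K ->
  (forall p, K p -> lin a b p < c) -> support a b K < c.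
Proof. by move=> cK Kc; have [p Kp ->] := support_attained a b cK; exact: Kc. Qed.

(** The function is Lipschitz: its constant is a bound for the second coordinate on [K], read off
    from the support values in the directions [(0, 1)] and [(0, -1)]. *)
Lemma support_continuous a K : compact_convex K ->
  continuous (fun t => support a t K).
Proof.
move=> cK.
pose M := `|support 0 1 K| + `|support 0 (-1) K|.
have yM p : K p -> `|p 0 1| <= M.
  move=> Kp; have := lin_le_support 0 1 cK Kp.
  have := lin_le_support 0 (-1) cK Kp.
  have := ler_norm (support 0 1 K); have := ler_norm (support 0 (-1) K).
  have := normr_ge0 (support 0 1 K); have := normr_ge0 (support 0 (-1) K).
  by rewrite ler_norml /lin /M => ? ? ? ? ? ?; apply/andP; split; lra.
have M0 : 0 <= M by rewrite addr_ge0.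
have half t t' : support a t K - support a t' K <= M * `|t - t'|.
  have [p Kp ->] := support_attained a t cK.
  have := lin_le_support a t' cK Kp.
  have : (t - t') * p 0 1 <= M * `|t - t'|.
    apply: le_trans (ler_norm _) _; rewrite normrM mulrC.
    by apply: ler_wpM2r => //; exact: yM.
  by rewrite /lin; lra.
move=> t; apply/cvgrPdist_lt => e e0.
near=> t'.
have : `|support a t K - support a t' K| <= M * `|t - t'|.
  by rewrite ler_norml half andbT lerNl opprB distrC half.
move=> /le_lt_trans; apply.
(* The denominator is [M + 1] because [M] may vanish. *)
have : `|t - t'| < e / (M + 1).
  by near: t'; apply: cvgr_dist_lt => //; rewrite divr_gt0//; lra.
rewrite ltr_pdivlMr; last by lra.
by have := normr_ge0 (t - t'); nra.
Unshelve. all: by end_near.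
Qed.

(* Up to positive scaling, the directions of the plane are [(+-1, t)], encoded
   as [(sign, Some t)], and [(0, +-1)], encoded as [(sign, None)]. *)
Definition dirx (d : bool * option R) : R :=
  if d.2 is Some _ then (-1) ^+ d.1 else 0.
Definition diry (d : bool * option R) : R :=
  if d.2 is Some t then t else (-1) ^+ d.1.

Lemma dir_normalize a b : (a, b) != (0, 0) ->
  exists d, exists2 r, 0 < r & a = r * dirx d /\ b = r * diry d.
Proof.
rewrite xpair_eqE negb_and => ab0; have [a0|a0] := eqVneq a 0.
  have b0 : b != 0 by move: ab0; rewrite a0 eqxx.
  exists (b < 0, None), `|b|; first by rewrite normr_gt0.
  by rewrite /dirx /diry /= mulr0 mulrC -numEsign.
exists (a < 0, Some (b / `|a|)), `|a|; first by rewrite normr_gt0.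
by rewrite /dirx /diry /= mulrC -numEsign; split=> //; field; rewrite normr_eq0.
Qed.

Definition height d K := support (dirx d) (diry d) K.

Lemma common_support_line s t K L : compact_convex K -> compact_convex L ->
  height (s, Some t) K = height (s, Some t) L ->
  common_supporting_line K L (line ((-1) ^+ s) t (height (s, Some t) K)).
Proof.
move=> cK cL eKL; rewrite /height /dirx /diry /= in eKL *.
set c := support _ _ K.
have hb : bounds (line ((-1) ^+ s) t c) (halfplane ((-1) ^+ s) t c).
  by exists ((-1) ^+ s), t, c; split => //; rewrite xpair_eqE signr_eq0.
have sub M : compact_convex M -> support ((-1) ^+ s) t M = c ->
    M `<=` halfplane ((-1) ^+ s) t c.
  by move=> cM <- p Mp; exact: (lin_le_support _ _ cM Mp).
have supp M : compact_convex M -> support ((-1) ^+ s) t M = c ->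
    supporting_line M (line ((-1) ^+ s) t c).
  move=> cM eM; split; last by exists (halfplane ((-1) ^+ s) t c); split=> //; exact: sub.
  have [p Mp hp] := support_attained ((-1) ^+ s) t cM.
  by exists p; split => //; rewrite /line /= -eM hp.
split; [exact: supp|exact: supp|].
by exists (halfplane ((-1) ^+ s) t c); split => //; exact: sub.
Qed.

(** With the first coefficient fixed to a sign, the points of the line with second coordinate 0 and
    1 determine [c] and then [t]. *)
Lemma line_sign_inj s t t' c c' :
  line ((-1) ^+ s) t c = line ((-1) ^+ s) t' c' -> t = t'.
Proof.
move=> e.
pose P x y : plane R := \row_j (if j == 0 then x else y).
have mP x y : (-1) ^+ s * x + t * y = c -> (-1) ^+ s * x + t' * y = c'.
  move=> h; have : line ((-1) ^+ s) t c (P x y) by rewrite /line /= !mxE.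
  by rewrite e /line /= !mxE.
have := mP ((-1) ^+ s * c) 0; rewrite !mulr0 !addr0 mulrA -expr2 sqrr_sign mul1r.
move=> /(_ erefl) cc'.
have := mP ((-1) ^+ s * (c - t)) 1; rewrite !mulr1 mulrA -expr2 sqrr_sign mul1r.
by rewrite subrK => /(_ erefl); lra.
Qed.

(** Each such [t] yields a common supporting line, and no line arises from two values of [t]. *)
Lemma card_equal_height K L k s : compact_convex K -> compact_convex L ->
  [set l | common_supporting_line K L l] #<= `I_k ->
  [set t | height (s, Some t) K = height (s, Some t) L] #<= `I_k.
Proof.
move=> cK cL; apply: card_le_trans.
pose f t := line ((-1) ^+ s) t (height (s, Some t) K).
set Z := [set t | _].
have fi : {in Z &, injective f} by move=> t t' _ _ /line_sign_inj.
have := inj_card_eq fi; rewrite card_eq_le => /andP[_ /card_le_trans]; apply.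
by apply: subset_card_le => _ [t Zt <-]; exact: common_support_line.
Qed.

End Planar.

(** * Counting sign patterns of functions with few zeros *)

Section SignPatterns.
Variable R : realType.

(** A sign change would force a zero between [t] and [t'], both included. Equal counts exclude
    listed points from [t] up to but not including [t']; if [t'] were listed, so would be [t], which
    is already excluded. *)
Lemma sign_stable_lt (g : R -> R) (s : seq R) t t' : continuous g ->
  (forall r, g r = 0 -> r \in s) -> t < t' ->
  count (< t) s = count (< t') s -> (t \in s) = (t' \in s) ->
  (g t < 0) = (g t' < 0).
Proof.
move=> cg gs tt' ec em.
have no r : r \in s -> t <= r -> r < t' -> False.
  move=> rs tr rt'.
  have : (count (< t) s < count (< t') s)%N; last by rewrite ec ltnn.
  have := count_predUI (< t) (pred1 r) s.
  have -> : count (predI (< t) (pred1 r)) s = 0%N.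
    rewrite (eq_count (a2 := pred0)) ?count_pred0// => x /=.
    by apply/negP => /andP[+ /eqP xr]; rewrite xr ltNge tr.
  rewrite addn0 => eU; have : (count (predU (< t) (pred1 r)) s <= count (< t') s)%N.
    apply: sub_count => x /= /orP[xt|/eqP ->//]; exact: lt_trans xt tt'.
  apply: leq_trans; rewrite eU -[leqLHS]addn1 leq_add2l.
  by rewrite -has_count has_pred1.
apply/idP/idP => h; rewrite ltNge; apply/negP => h';
have [|| r /[!in_itv]/= /andP[tr rt'] /gs rs] := @IVT R g t t' 0 (ltW tt').
- exact: continuous_subspaceT.
- by rewrite ge_min le_max (ltW h) h' orbT.
- move: rt'; rewrite le_eqVlt => /orP[/eqP rt'|rt']; last exact: (no r).
  by apply: (no t) => //; rewrite em -rt'.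
- exact: continuous_subspaceT.
- by rewrite ge_min le_max (ltW h) h' orbT.
- move: rt'; rewrite le_eqVlt => /orP[/eqP rt'|rt']; last exact: (no r).
  by apply: (no t) => //; rewrite em -rt'.
Qed.

Lemma sign_stable (g : R -> R) (s : seq R) t t' : continuous g ->
  (forall r, g r = 0 -> r \in s) ->
  count (< t) s = count (< t') s -> (t \in s) = (t' \in s) ->
  (g t < 0) = (g t' < 0).
Proof.
move=> cg gs ec em; have [tt'|t't|->//] := ltgtP t t'.
  exact: (sign_stable_lt cg gs).
by apply/esym; exact: (sign_stable_lt cg gs).
Qed.

(* [z s] lists all zeros on the chart [s]. The sign pattern at [t] depends only
   on the number of listed zeros below [t] and on whether [t] is listed. *)
Lemma card_sign_patterns (U I : finType) (k : nat)
    (g : U -> bool * option R -> R) (d : I -> bool * option R) :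
  (forall y s, continuous (fun t => g y (s, Some t))) ->
  (forall y s, [set t | g y (s, Some t) = 0] #<= `I_k) ->
  (forall i j, (forall y, (g y (d i) < 0) = (g y (d j) < 0)) -> i = j) ->
  (#|I| <= 4 * (#|U| * k) + 6)%N.
Proof.
move=> gc gz dinj.
pose z s : seq R := flatten
  [seq finmap.enum_fset (fset_set [set t | g y (s, Some t) = 0]) | y <- enum U].
have zP y s r : g y (s, Some r) = 0 -> r \in z s.
  move=> gr; apply/flattenP.
  exists (finmap.enum_fset (fset_set [set t | g y (s, Some t) = 0])).
    by apply/mapP; exists y => //; rewrite mem_enum.
  have fin : finite_set [set t | g y (s, Some t) = 0].
    by apply/finite_set_leP; exists k.
  by have -> : r \in finmap.enum_fset (fset_set [set t | g y (s, Some t) = 0]) =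
    (r \in [set t | g y (s, Some t) = 0]);
    [exact: (in_fset_set fin r)|exact/mem_set].
have sz s : (size (z s) <= #|U| * k)%N.
  rewrite /z size_flatten /shape -map_comp cardE.
  elim: (enum U) => //= y e IH; rewrite mulSn leq_add//.
  exact: geq_card_fset_set.
(* A direction [(0, +-1)] is coded by its sign alone. The [.+1] leaves room for a count equal to the
   maximal length, so that [inord] loses nothing. *)
pose code i : bool * option ('I_(#|U| * k).+1 * bool) :=
  ((d i).1, if (d i).2 is Some t
            then Some (inord (count (< t) (z (d i).1)), t \in z (d i).1)
            else None).
have ci : injective code.
  move=> i j; rewrite /code => -[]; case Ei : (d i) => [s o]; case Ej : (d j) => [s' o'] /=.
  move=> ss'; rewrite -{}ss' in Ej *.
  case: o Ei => [t|] Ei; case: o' Ej => [t'|] Ej //; last first.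
    by move=> _; apply: dinj => y; rewrite Ei Ej.
  move=> -[ec em]; apply: dinj => y; rewrite Ei Ej.
  apply: (@sign_stable (fun t => g y (s, Some t)) (z s)) => //.
    exact: zP.
  move: ec => /(congr1 val); rewrite /= !inordK// ltnS;
  exact: leq_trans (count_size _ _) (sz s).
(* There are [2 * (1 + 2 * (#|U| * k + 1))] codes. *)
have := leq_card code ci.
rewrite card_prod card_option card_prod card_ord card_bool; lia.
Qed.

End SignPatterns.

(** * The block geometry and its planar representations *)

Section Geometry.

(** [None] is the adjoined point P; the closed sets without it are exactly the subsets of blocks. *)
Definition block_closure (U I : Type) (B : I -> set U) (S : set (option U)) :
    set (option U) :=
  S `|` [set o | o = None /\ forall i, ~ S `<=` Some @` B i].

(** Closure can only add [None], so two distinct points violating anti-exchange would both be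
    [None]. The empty set is closed because some block exists. *)
Lemma block_closure_geometry (U : finType) (I : Type) (B : I -> set U) :
  inhabited I -> convex_geometry setT (block_closure B).
Proof.
move=> [i0]; split=> //.
- by move=> A _ x Ax; left.
- move=> A A' AA' _ x [Ax|[-> hA]]; [by left; exact: AA'|right; split=> // i A'B].
  by apply: (hA i) => y /AA' /A'B.
- move=> A _; apply/seteqP; split=> [x [//|[-> hA]]|x Ax]; last by left.
  right; split=> // i AB; apply: (hA i) => y [/AB//|[_ /(_ i)]].
  by case.
- by apply/seteqP; split=> // x [//|[_ /(_ i0)]]; case.
- move=> A x y _ [_ nx] [_ ny] e; apply: contrapT => xy.
  have new u v : u <> v -> ~ block_closure B A u ->
      block_closure B (A `|` [set v]) u -> u = None.
    by move=> uv nu [[Au|//]|[]//]; case: nu; left.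
  have xN : x = None by apply: (new _ y) => //; rewrite -e; left; right.
  have yN : y = None by apply: (new _ x) => //; [exact/nesym|rewrite e; left; right].
  by rewrite xN yN in xy.
Qed.

Variable R : realType.

Lemma conv_family_idem (F S : set (set (plane R))) :
  conv_family F (conv_family F S) = conv_family F S.
Proof.
apply/seteqP; split=> K [FK KS]; split=> //.
  apply: subset_trans KS _; apply: smallest_sub; first exact: convex_hull_convex.
  by move=> p [L [_ LS] /LS].
move=> p Kp; apply: sub_gen_smallest.
by exists K.
Qed.

(* Some direction separates [f None] strictly from the hull of the two sets of
   the block [B i]. A further set [f (Some z)] that is also lower than [f None]
   there would leave [f None] outside the hull of all three, although [None] is
   in the closure of [B i] and [z]. *)
Lemma block_direction (U I : Type) (B : I -> set U)
    (F : set (set (plane R))) (f : option U -> set (plane R)) (x y : U) (i : I) :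
  (forall K, F K -> compact_convex K) ->
  set_bij setT F f ->
  (forall X, X `<=` setT -> (convex_in setT (block_closure B) X <->
     convex_in F (conv_family F) (f @` X))) ->
  (forall i j, B i `<=` B j -> i = j) ->
  B i = [set x; y] ->
  exists d, forall z, height d (f (Some z)) - height d (f None) < 0 <-> B i z.
Proof.
move=> cF [fF finj fsurj] iso anti Bi.
have Ff o : F (f o) by exact: fF.
have cf o : compact_convex (f o) by exact: cF.
have fI : injective f by move=> o o' /finj; apply; rewrite in_setT.
have inF X : f @` X `<=` F by move=> _ [w _ <-].
have Cx : convex_in setT (block_closure B) (Some @` B i).
  split=> //; apply/seteqP; split=> [w [//|[_ /(_ i)]]|w Bw]; last by left.
  by case.
have {Cx} [_ Cx] := (iso _ (@subsetT _ _)).1 Cx.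
(* The block is closed and misses [None], so its image is closed in [F] and, [f] being injective,
   misses [f None]. *)
have nsub : ~ f None `<=` convex_hull (f (Some x) `|` f (Some y)).
  move=> h; have : [set f o | o in Some @` B i] (f None).
    rewrite -Cx; split=> //; apply: subset_trans h _.
    apply: sub_smallest2r; first exact: convex_hull_convex.
    move=> p [fp|fp].
      by exists (f (Some x)) => //; exists (Some x) => //; exists x => //; rewrite Bi; left.
    by exists (f (Some y)) => //; exists (Some y) => //; exists y => //; rewrite Bi; right.
  by move=> [w [u _ <-] /fI].
have [p [fp np]] : exists p, f None p /\ ~ convex_hull (f (Some x) `|` f (Some y)) p.
  by apply: contrapT => h; apply: nsub => p fp; apply: contrapT => np; apply: h; exists p.
have [a [b sep]] := separation (cf _) (cf _) np.
have ab0 : (a, b) != (0, 0).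
  apply/eqP => -[a0 b0]; have [[q fq] _ _] := cf (Some x).
  by have := sep q (or_introl fq); rewrite a0 b0 /lin !mul0r ltxx.
have [d [r r0 [ea eb]]] := dir_normalize ab0.
have linE q : lin a b q = r * lin (dirx d) (diry d) q by rewrite /lin ea eb; ring.
have below z : B i z -> height d (f (Some z)) < height d (f None).
  move=> Bz; apply: lt_le_trans (lin_le_support _ _ (cf None) fp).
  apply: support_lt => // q fq.
  have : lin a b q < lin a b p.
    by apply: sep; move: Bz fq; rewrite Bi => -[->|->]; [left|right].
  by rewrite !linE ltr_pM2l.
exists d => z; rewrite subr_lt0; split=> [hz|]; last exact: below.
apply: contrapT => nBz.
pose Y := Some @` (B i `|` [set z]).
(* No block includes [Y]: it would include [B i], hence equal it by [anti], and would also contain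
   [z]. *)
have NY' X : Y `<=` X -> convex_in setT (block_closure B) X -> X None.
  move=> YX [_ <-]; right; split=> // j YB.
  have sub : B i `|` [set z] `<=` B j.
    by move=> u Bu; have [|v Bv [<-]//] := YB (Some u); apply: YX; exists u.
  apply: nBz; rewrite (anti i j); first by apply: sub; right.
  by move=> u Bu; apply: sub; left.
(* The isomorphism is given on closed sets, not on closures, so the closure of the image of [Y] is
   pulled back to a closed set including [Y]. *)
pose X := f @^-1` (conv_family F (f @` Y)).
have fX : f @` X = conv_family F (f @` Y).
  apply/seteqP; split=> [_ [w Xw <-]//|K XK].
  have [FK _] := XK; have [w _ fw] := fsurj K FK.
  by exists w => //; rewrite /X /preimage /= fw.
have : X None.
  apply: NY'.
    move=> o Yo; split=> // q fq; apply: sub_gen_smallest.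
    by exists (f o) => //; exists o.
  apply/iso => //; split; first exact: inF.
  by rewrite fX conv_family_idem.
move=> [_ hN].
(* [f None] now lies in the hull of sets strictly below its height, yet reaches that height at
   [q]. *)
have [q fq hq] := support_attained (dirx d) (diry d) (cf None).
have : lin (dirx d) (diry d) q < height d (f None).
  apply: convex_hull_lin_lt (hN q fq) => v [_ [w [u Bu <-] <-] fu].
  apply: le_lt_trans (lin_le_support _ _ (cf _) fu) _.
  by case: Bu => [/below|->].
by rewrite -hq ltxx.
Qed.

End Geometry.

(** * Contradiction from counting the blocks *)

Theorem theorem5p3 (R : realType) :
  ~ exists k0 : nat,
      forall (T : Type) (E : set T) (Phi : set T -> set T),
        convex_geometry E Phi ->
        exists F : set (set (plane R)),
          [/\ finite_set F,
              forall K, F K -> compact_convex K,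
              forall K L, F K -> F L -> K <> L ->
                [set l | common_supporting_line K L l] #<= `I_k0
            & geometry_isomorphic E Phi F (conv_family F)].
Proof.
move=> [k repr].
(* For [n = 8k + 7], the number of blocks [n^2 = 8kn + 7n] exceeds [8kn + 6], the bound on sign
   patterns of [2n] functions. *)
pose n := (8 * k).+4.+3.
pose B (ij : 'I_n * 'I_n) : set ('I_n + 'I_n) := [set inl ij.1; inr ij.2].
have anti ij ij' : B ij `<=` B ij' -> ij = ij'.
  case: ij ij' => [i j] [i' j'] sub.
  have [[->]|//] := sub (inl i) (or_introl erefl).
  by have [//|[->]] := sub (inr j) (or_intror erefl).
have [F [_ cF kF [f [fbij iso]]]] :=
  repr _ _ _ (block_closure_geometry B (inhabits (ord0, ord0))).
have [fF finj _] := fbij.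
have Ff o : F (f o) by exact: fF.
have fN z : f (Some z) <> f None by move=> /finj; rewrite !in_setT => /(_ isT isT).
have dir ij : exists d, forall z,
    height d (f (Some z)) - height d (f None) < 0 <-> B ij z.
  exact: (@block_direction R _ _ B F f (inl ij.1) (inr ij.2) ij).
have [d dP] := choice dir.
have : (#|{: 'I_n * 'I_n}| <= 4 * (#|{: 'I_n + 'I_n}| * k) + 6)%N; last first.
  by rewrite card_prod card_sum !card_ord /n; nia.
apply: (@card_sign_patterns R _ _ k
  (fun z d => height d (f (Some z)) - height d (f None)) d).
- move=> y s t; apply: continuousB; exact: support_continuous (cF _ (Ff _)) _.
- move=> y s.
  have -> : [set t | height (s, Some t) (f (Some y)) - height (s, Some t) (f None) = 0] =
      [set t | height (s, Some t) (f (Some y)) = height (s, Some t) (f None)].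
    by apply/seteqP; split=> t /= h; [exact: subr0_eq|rewrite h subrr].
  by apply: card_equal_height; [exact: cF..|exact: kF].
(* The negative entries at [d i] are exactly the members of [B i], so equal patterns give equal
   blocks. *)
- move=> i j e; apply: anti => z Bz.
  by apply/(dP j); rewrite -e; apply/(dP i).
Qed.
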